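(* Every partial Hamming graph is smooth.
   Context: Graphs are simple and undirected; $d$ denotes the shortest path distance of a connected graph $G$. Intervals: $I[u,v]=\{w\in V(G): d(u,w)+d(w,v)=d(u,v)\}$; $N(u)=\{w: d(u,w)=1\}$; the step system (step function) of $G$ is $S(u,v)=I[u,v]\cap N(u)$. A connected graph $G$ is smooth if for all vertices $u,v,w,x,y$: $v\in S(u,w)$, $v\in S(u,y)$ and $x\in S(w,y)$ imply $v\in S(u,x)$. A Hamming graph is a Cartesian product of (finitely many) complete graphs. An isometric subgraph of $G$ is an induced subgraph $G[W]$ with $d_{G[W]}(u,v)=d_G(u,v)$ for all $u,v\in W$. A partial Hamming graph is an isometric subgraph of a Hamming graph. *)

(* Defs.v *)
From HB Require Import structures.
From mathcomp Require Import all_boot.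
From mathcomp Require Import boolp classical_sets.

Set Implicit Arguments.
Unset Strict Implicit.
Unset Printing Implicit Defensive.

Local Open Scope classical_set_scope.

(* Vertex types are arbitrary, so graphs may be finite or infinite. *)
Record sgraph := SGraph {
  vertex :> Type;
  adj : rel vertex;
  adj_sym : symmetric adj;
  adj_irr : irreflexive adj }.

Section Metric.
Variable G : sgraph.
Implicit Types u v w x y : G.

Definition walk u v (n : nat) : Prop :=
  exists p : seq G, [/\ path (@adj G) u p, last u p = v & size p = n].

Definition connected_graph : Prop := forall u v, exists n, walk u v n.

Definition shortest_walk u v : set nat :=
  [set n | walk u v n /\ forall m, walk u v m -> n <= m].

(* The default value 0 is used exactly when no walk joins u to v; since then
   u <> v, it is never confused with the distance between joined vertices. *)
Definition dist u v : nat := xget 0 (shortest_walk u v).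

Definition interval u v : set G := [set w | dist u w + dist w v = dist u v].

Definition neighborhood u : set G := [set w | dist u w = 1].

Definition step u v : set G := interval u v `&` neighborhood u.

Definition smooth : Prop :=
  connected_graph /\
  forall u v w x y,
    step u w v -> step u y v -> step w y x -> step u x v.

End Metric.

Section Complete.
Variable X : Type.

Definition complete_adj : rel X := fun x y => `[< x <> y >].

Lemma complete_adj_sym : symmetric complete_adj.
Proof. by move=> x y; apply/asboolP/asboolP => xy /esym. Qed.

Lemma complete_adj_irr : irreflexive complete_adj.
Proof. by move=> x; apply/asboolP. Qed.

Definition complete_graph : sgraph := SGraph complete_adj_sym complete_adj_irr.

End Complete.

Section CartesianProduct.
Variables (n : nat) (G : 'I_n -> sgraph).

Definition cartesian_adj : rel (forall i, G i) := fun x y =>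
  `[< exists i, adj (x i) (y i) /\ forall j, j <> i -> x j = y j >].

Lemma cartesian_adj_sym : symmetric cartesian_adj.
Proof.
move=> x y; apply/asboolP/asboolP => -[i [xy e]]; exists i;
  by split=> [|j /e //]; rewrite adj_sym.
Qed.

Lemma cartesian_adj_irr : irreflexive cartesian_adj.
Proof. by move=> x; apply/asboolP => -[i []]; rewrite adj_irr. Qed.

Definition cartesian_product : sgraph :=
  SGraph cartesian_adj_sym cartesian_adj_irr.

End CartesianProduct.

Definition hamming_graph (n : nat) (A : 'I_n -> Type) : sgraph :=
  cartesian_product (fun i => complete_graph (A i)).

Section Induced.
Variables (G : sgraph) (W : set G).

Definition induced_adj : rel (set_type W) := fun x y => adj (val x) (val y).

Lemma induced_adj_sym : symmetric induced_adj.
Proof. by move=> x y; exact: adj_sym. Qed.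

Lemma induced_adj_irr : irreflexive induced_adj.
Proof. by move=> x; exact: adj_irr. Qed.

Definition induced_subgraph : sgraph := SGraph induced_adj_sym induced_adj_irr.

Definition isometric : Prop :=
  forall u v : induced_subgraph, dist u v = dist (G := G) (val u) (val v).

End Induced.

Definition isomorphic (G H : sgraph) : Prop :=
  exists2 f : G -> H, bijective f & {mono f : u v / adj u v}.

(* As usual for abstract graphs, up to isomorphism. *)
Definition partial_hamming (G : sgraph) : Prop :=
  exists (n : nat) (A : 'I_n -> Type) (W : set (hamming_graph A)),
    isometric W /\ isomorphic G (induced_subgraph W).

(* Main.v *)
From mathcomp Require Import all_boot.
From mathcomp Require Import boolp classical_sets.
Require Import Defs.

Set Implicit Arguments.
Unset Strict Implicit.
Unset Printing Implicit Defensive.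

Local Open Scope classical_set_scope.

(** In a Hamming graph the shortest path distance is the number of coordinates
in which two vertices differ ([dist_hamming]).  This sum is additive along
x, z, y exactly when it is additive in every coordinate, so z lies between x
and y exactly when each coordinate of z is taken from x or from y
([hamming_betweenP]).  A partial Hamming graph carries the restriction of this
distance ([dist_partial_hamming]), so its intervals are described by the same
coordinatewise condition.

Smoothness can then be read off one coordinate at a time
([hamming_between_smooth]).  Suppose that v lies between u and w and between u
and y, and that x lies between w and y.  In a coordinate where v differs from
u, v must agree with both w and y, which therefore agree with each other and
force x to have that value too; hence v lies between u and x. *)

Section Walks.
Variable G : sgraph.
Implicit Types u v w : G.

Lemma walk_refl u : walk u u 0.
Proof. by exists [::]. Qed.

Lemma walk_cons u v w n : adj u v -> walk v w n -> walk u w n.+1.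
Proof. by move=> uv [p [pp lp sp]]; exists (v :: p); rewrite /= uv pp lp sp. Qed.

Lemma dist_shortest u v n :
  walk u v n -> (forall m, walk u v m -> n <= m) -> dist u v = n.
Proof.
move=> wn minn; apply: xget_unique; first by split.
by move=> m [wm minm]; apply/eqP; rewrite eqn_leq minm // minn.
Qed.

Lemma dist_no_walk u v : (forall n, ~ walk u v n) -> dist u v = 0.
Proof. by move=> nw; apply: xgetPN => n [/nw]. Qed.

End Walks.

Lemma walk_morphism (G H : sgraph) (f : G -> H) u v n :
  {homo f : x y / adj x y} -> walk u v n -> walk (f u) (f v) n.
Proof.
move=> f_adj [p [pp lp sp]]; exists (map f p).
rewrite size_map last_map lp; split=> //.
by rewrite path_map; apply: sub_path pp => x y; exact: f_adj.
Qed.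

Section Isomorphism.
Variables (G H : sgraph) (f : G -> H).
Hypotheses (f_bij : bijective f) (f_adj : {mono f : u v / adj u v}).

Lemma walk_iso u v n : walk (f u) (f v) n <-> walk u v n.
Proof.
split=> [|uv]; last by apply: walk_morphism uv => x y; rewrite f_adj.
case: f_bij => g fK gK /(@walk_morphism _ _ g); rewrite !fK; apply=> x y.
by rewrite -f_adj !gK.
Qed.

Lemma dist_iso u v : dist (f u) (f v) = dist u v.
Proof.
rewrite /dist; congr xget; apply/seteqP; split=> n [wn minn].
  by split=> [|m wm]; [apply/walk_iso | apply/minn/walk_iso].
by split=> [|m wm]; [apply/walk_iso | apply/minn/walk_iso].
Qed.

End Isomorphism.

Section Hamming.
Variables (n : nat) (A : 'I_n -> Type).
Implicit Types u v w x y z : hamming_graph A.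

Definition hamming_dist x y : nat := \sum_(i < n) `[< x i <> y i >].

Definition hamming_between x z y : Prop :=
  forall i, z i = x i \/ z i = y i.

Lemma neq_triangle (T : Type) (a b c : T) :
  `[< a <> c >] <= `[< a <> b >] + `[< b <> c >].
Proof.
case: asboolP => //= ac; case: asboolP => //= /contrapT ab.
by case: asboolP => //= /contrapT bc; case: ac; rewrite ab.
Qed.

Lemma neq_additive (T : Type) (a b c : T) :
  (`[< a <> c >] == `[< a <> b >] + `[< b <> c >] :> nat) <->
  b = a \/ b = c.
Proof.
have neqxx (t : T) : `[< t <> t >] = false by apply/asboolP.
split=> [|[->|->]]; last 2 first.
- by rewrite neqxx.
- by rewrite neqxx addn0.
case: (asboolP (a <> b)) => [ab|/contrapT -> _]; last by left.
case: (asboolP (b <> c)) => [bc|/contrapT -> _]; last by right.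
by case: asboolP.
Qed.

Lemma hamming_triangle x y z :
  hamming_dist x y <= hamming_dist x z + hamming_dist z y.
Proof.
by rewrite -big_split /=; apply: leq_sum => i _; exact: neq_triangle.
Qed.

(** The triangle inequality holds coordinate by coordinate, so equality of the
sums forces equality of all the terms. *)
Lemma hamming_betweenP x z y :
  hamming_dist x z + hamming_dist z y = hamming_dist x y <->
  hamming_between x z y.
Proof.
rewrite -big_split /=.
have [_ sumE] := leqif_sum (fun i (_ : true) =>
  leqif_eq (neq_triangle (x i) (z i) (y i))).
split=> [/esym/eqP|xzy]; last first.
  by apply/esym/eqP; rewrite sumE; apply/forallP => i; exact/neq_additive.
by rewrite sumE => /forallP xzy i; exact/neq_additive/xzy.
Qed.

Lemma hamming_dist_xx x : hamming_dist x x = 0.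
Proof. by rewrite /hamming_dist big1 // => i _; case: asboolP. Qed.

Lemma hamming_dist_eq0 x y : hamming_dist x y = 0 -> x = y.
Proof.
move/eqP; rewrite sum_nat_eq0 => /forallP xy.
apply: functional_extensionality_dep => i.
by have := xy i; rewrite eqb0 => /asboolP/contrapT.
Qed.

Lemma hamming_dist_adj x y : adj x y -> hamming_dist x y = 1.
Proof.
move=> /asboolP[i [/asboolP xyi xyE]].
rewrite /hamming_dist (bigD1 i) //= big1 => [|j /eqP /xyE ->].
  by case: asboolP.
by case: asboolP.
Qed.

Lemma hamming_dist_walk_le x y m : walk x y m -> hamming_dist x y <= m.
Proof.
case=> p [pp <- <-] {y m}; elim: p x pp => [|z p IHp] x /=.
  by rewrite hamming_dist_xx.
move=> /andP[xz pp]; apply: leq_trans (hamming_triangle _ _ z) _.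
by rewrite (hamming_dist_adj xz) add1n ltnS IHp.
Qed.

(** Replacing one coordinate of x at which it differs from y by that of y gives
a neighbor of x between x and y, hence one unit closer to y. *)
Lemma walk_hamming_dist x y : walk x y (hamming_dist x y).
Proof.
have [m] := ubnP (hamming_dist x y); elim: m x => // m IHm x xym.
have [/hamming_dist_eq0 xy|] := eqVneq (hamming_dist x y) 0.
  by rewrite xy hamming_dist_xx; exact: walk_refl.
rewrite sum_nat_eq0 => /forallPn[/= i]; rewrite eqb0 negbK => /asboolP xyi.
pose z : hamming_graph A := dfwith x (y i).
have xz : adj x z.
  apply/asboolP; exists i; split; first by rewrite /z dfwith_in; exact/asboolP.
  by move=> j /eqP ji; rewrite /z dfwith_out // eq_sym.
have /hamming_betweenP xzy : hamming_between x z y.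
  by move=> j; rewrite /z; case: dfwithP; [right | left].
move: xym; rewrite -xzy (hamming_dist_adj xz) add1n ltnS => zym.
exact: walk_cons xz (IHm z zym).
Qed.

Lemma dist_hamming x y : dist x y = hamming_dist x y.
Proof.
by apply: dist_shortest; [exact: walk_hamming_dist | exact: hamming_dist_walk_le].
Qed.

Lemma hamming_between_smooth u v w x y :
  hamming_between u v w -> hamming_between u v y -> hamming_between w x y ->
  hamming_between u v x.
Proof.
move=> uvw uvy wxy i.
case: (uvw i) => [|vw]; first by left.
case: (uvy i) => [|vy]; first by left.
by right; case: (wxy i) => ->.
Qed.

End Hamming.

Section PartialHamming.
Variables (n : nat) (A : 'I_n -> Type) (W : set (hamming_graph A)).
Variables (G : sgraph) (f : G -> induced_subgraph W).
Hypotheses (W_isom : isometric W) (f_bij : bijective f).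
Hypothesis f_adj : {mono f : u v / adj u v}.

Lemma dist_partial_hamming u v :
  dist u v = hamming_dist (val (f u)) (val (f v)).
Proof. by rewrite -(dist_iso f_bij f_adj) W_isom dist_hamming. Qed.

Lemma interval_partial_hammingP u v w :
  interval u v w <-> hamming_between (val (f u)) (val (f w)) (val (f v)).
Proof.
by rewrite /interval /= !dist_partial_hamming; exact: hamming_betweenP.
Qed.

(** Two vertices joined by no walk would be at distance 0, hence have the same
coordinates in the Hamming graph and be equal; but a vertex is joined to itself
by the walk of length 0. *)
Lemma connected_partial_hamming : connected_graph G.
Proof.
move=> u v; apply: contrapT => /forallNP nouv.
have := dist_no_walk nouv; rewrite dist_partial_hamming.
move=> /hamming_dist_eq0 /val_inj /(bij_inj f_bij) uv.
by apply: (nouv 0); rewrite uv; exact: walk_refl.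
Qed.

End PartialHamming.

Theorem mainTheorem8 (G : sgraph) (hG : partial_hamming G) : smooth G.
Proof.
case: hG => n [A [W [W_isom [f f_bij f_adj]]]].
have betweenP := interval_partial_hammingP W_isom f_bij f_adj.
split; first exact: connected_partial_hamming W_isom f_bij f_adj.
move=> u v w x y [uw uv] [uy _] [wy _]; split=> //.
move: uw uy wy => /betweenP uvw /betweenP uvy /betweenP wxy.
exact/betweenP/(hamming_between_smooth uvw uvy wxy).
Qed.
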